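(* Let $1<\alpha\le2$, $\beta\in\mathbb{R}$, and let $U^n\in\mathcal{V}_h$, $0\le n\le N_t$, be the numerical solution of the scheme $$\mathrm{i}\,\delta_t^+U^n-D_\alpha U^{n+1/2}+F(U^n,U^{n+1})=0,\qquad 0\le n\le N_t-1.$$ Then the numerical solution is bounded in the following sense: $$\|U^n\|_h\le C_1,\qquad |U^n|_{H^{\alpha/2}_h}\le C_2,\qquad \|U^n\|_{l^\infty_h}\le C_3,\qquad 0\le n\le N_t,$$ where $C_1,C_2,C_3$ are some positive constants.
   Context: The scheme is a Fourier pseudo-spectral (space) and Crank-Nicolson (time) discretization of the space fractional nonlinear Schrödinger equation $\mathrm{i}u_t-(-\Delta)^{\alpha/2}u+\beta|u|^2u=0$ on $\Omega=[a,b]$, $0<t\le T$, with periodic boundary conditions of period $L=b-a$ and a given initial condition. Let $\mu=2\pi/L$, $N$ an even positive integer, $h=L/N$, $x_j=a+jh$; $N_t$ a positive integer, $\tau=T/N_t$. $\mathcal{V}_h$ is the space of complex-valued ($L$-periodic) grid functions $u=(u_j)$ on the points $x_j$. $\delta_t^+U^n=(U^{n+1}-U^n)/\tau$ and $U^{n+1/2}=\frac12(U^{n+1}+U^n)$. Inner product and norms: $(u,v)_h=\frac1N\sum_{j=0}^{N-1}u_j\overline{v}_j$, $\|u\|_h^2=(u,u)_h$, $\|u\|_{l^\infty_h}=\max_{0\le j\le N-1}|u_j|$. Discrete Fourier coefficients: $\widehat u_k=\frac1N\sum_{j=0}^{N-1}u_je^{-\mathrm{i}k\mu x_j}$, $-N/2\le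 k\le N/2-1$. Semi-norm, for $\sigma\in[0,1]$: $|u|^2_{H^\sigma_h}=\sum_{k=-N/2}^{N/2-1}|\mu k|^{2\sigma}|\widehat u_k|^2$. Discrete fractional Laplacian: $(D_\alpha u)_j=\sum_{k=-N/2}^{N/2-1}|\mu k|^\alpha\widehat u_ke^{\mathrm{i}k\mu x_j}$. Nonlinear term: $F(U^n,U^{n+1})_j=\frac\beta4\big(|U^n_j|^2+|U^{n+1}_j|^2\big)\big(U^n_j+U^{n+1}_j\big)$. *)

(* Defs.v *)
From HB Require Import structures.
From mathcomp Require Import all_boot all_order all_algebra.
From mathcomp Require Import complex.
From mathcomp Require Import reals exp trigo.

Set Implicit Arguments.
Unset Strict Implicit.
Unset Printing Implicit Defensive.

Import Order.TTheory GRing.Theory Num.Theory.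

Local Open Scope ring_scope.
Local Open Scope complex_scope.

(* An L-periodic grid function is determined by its values on one period
   x_0, ..., x_{N-1}. *)
Definition grid (R : realType) (N : nat) := {ffun 'I_N -> R[i]}.

Definition cmod (R : realType) (z : R[i]) : R := ComplexField.Normc.normc z.

Definition cexpi (R : realType) (t : R) : R[i] := cos t +i* sin t.

Section Space.
Context {R : realType}.
Variables (a b : R) (N : nat).
Implicit Types u v : grid R N.

Definition mu : R := 2 * pi / (b - a).

Definition mesh : R := (b - a) / N%:R.

Definition node (j : nat) : R := a + j%:R * mesh.

(* The modes -N/2 <= k <= N/2 - 1 (N even) are enumerated by m : 'I_N through
   k = m - N/2. *)
Definition mode (m : 'I_N) : int := m%:Z - (N./2)%:Z.

Definition inner_h u v : R[i] := N%:R^-1 * \sum_(j < N) u j * conjc (v j).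

(* (u, u)_h is real and nonnegative. *)
Definition norm_h u : R := Num.sqrt (complex.Re (inner_h u u)).

Definition norm_linf u : R := \big[Num.max/0]_(j < N) cmod (u j).

Definition dft u (k : int) : R[i] :=
  N%:R^-1 * \sum_(j < N) u j * cexpi (- (k%:~R * mu * node j)).

Definition seminormH (s : R) u : R :=
  Num.sqrt (\sum_(m < N)
    `|mu * (mode m)%:~R| `^ (2 * s) * cmod (dft u (mode m)) ^+ 2).

Definition Dfrac (alpha : R) u : grid R N :=
  [ffun j : 'I_N => \sum_(m < N)
     (`|mu * (mode m)%:~R| `^ alpha)%:C * dft u (mode m)
       * cexpi ((mode m)%:~R * mu * node j)].

Definition nonlin (beta : R) u v : grid R N :=
  [ffun j => (beta / 4 * (cmod (u j) ^+ 2 + cmod (v j) ^+ 2))%:C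
               * (u j + v j)].

End Space.

Section Scheme.
Context {R : realType}.
Variables (a b T alpha beta : R) (N Nt : nat).
Implicit Types U : nat -> grid R N.

Definition tau : R := T / Nt%:R.

Definition dt_plus U (n : nat) : grid R N := (tau^-1)%:C *: (U n.+1 - U n).

Definition midpoint U (n : nat) : grid R N := (2^-1 : R[i]) *: (U n.+1 + U n).

Definition scheme_solution U : Prop :=
  forall n, (n < Nt)%N ->
    (0 +i* 1) *: dt_plus U n - Dfrac a b alpha (midpoint U n)
      + nonlin beta (U n) (U n.+1) = 0.

End Scheme.

(* Main.v *)
Require Import Defs.
From mathcomp Require Import all_boot all_order all_algebra.
From mathcomp Require Import complex.
From mathcomp Require Import reals sequences exp trigo.
From mathcomp Require Import ring lra.

(** Write M(u) for the squared discrete L2 norm, |u|^2 for the squared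
    H^(alpha/2) semi-norm and Q(u) for the mean of the fourth powers |u_j|^4.
    One step of the scheme from u to v conserves two quantities.  Pairing the
    equation with v + u and taking imaginary parts gives M(v) = M(u)
    ([mass_step]): the dispersive and the nonlinear terms are real multiples of
    squared moduli, so only the time difference contributes.  Pairing it with
    v - u and taking real parts gives conservation of |u|^2 - (beta/2) Q(u)
    ([energy_step]): the time difference drops out, and the product
    (|u_j|^2 + |v_j|^2)(u_j + v_j) in the nonlinearity is made so that its
    pairing with v_j - u_j has real part |v_j|^4 - |u_j|^4.

    The energy bounds the semi-norm once Q is dominated by it, whatever the
    sign of beta.  As Q(u) is at most the squared sup norm times M(u), and M is
    constant in time, it suffices to have, for every eps > 0, a constant K with
      sup |u_j|^2 <= eps |u|^2 + K M(u)
    for all even N and all grid functions u ([discrete_sobolev]).  With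
    eps = 1 / (1 + |beta| M0^2), M0 being a bound for the initial L2 norm, half of
    the squared semi-norm is absorbed, which bounds it, and a
    second use of the same inequality bounds the sup norm.

    The interpolation inequality comes from the discrete Fourier inversion
    formula, which bounds the sup norm by the sum of the |u^_k|, and from a
    Cauchy-Schwarz inequality with weights (B + 1 + |k|)^alpha.  The inverse
    weights have sum at most 2 B^(1-alpha) / (alpha - 1) uniformly in N
    ([sum_powR_le], [sum_mode_le]): this is where alpha > 1 enters, and the
    bound tends to 0 as B grows, which makes eps arbitrary. *)

Import Order.TTheory GRing.Theory Num.Theory.
Local Open Scope ring_scope.

(** * Complex exponentials *)

Section ComplexArithmetic.
Local Open Scope complex_scope.
Set Implicit Arguments.
Unset Strict Implicit.
Context {R : realType}.
Implicit Types z w : R[i].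

Lemma Re_sum (I : Type) (r : seq I) (P : pred I) (F : I -> R[i]) :
  complex.Re (\sum_(i <- r | P i) F i) = \sum_(i <- r | P i) complex.Re (F i).
Proof. by apply: big_morph => // -[a b] [c d]. Qed.

Lemma Im_sum (I : Type) (r : seq I) (P : pred I) (F : I -> R[i]) :
  complex.Im (\sum_(i <- r | P i) F i) = \sum_(i <- r | P i) complex.Im (F i).
Proof. by apply: big_morph => // -[a b] [c d]. Qed.

Lemma Re_scale (c : R) z : complex.Re (c%:C * z) = c * complex.Re z.
Proof. by case: z => x y /=; rewrite mul0r subr0. Qed.

Lemma Im_scale (c : R) z : complex.Im (c%:C * z) = c * complex.Im z.
Proof. by case: z => x y /=; rewrite mul0r addr0. Qed.

Lemma cmod_ge0 z : 0 <= cmod z.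
Proof. by case: z => x y; exact: sqrtr_ge0. Qed.

Lemma cmod_sqr z : cmod z ^+ 2 = complex.Re z ^+ 2 + complex.Im z ^+ 2.
Proof. by case: z => x y; rewrite /cmod /= sqr_sqrtr ?addr_ge0 ?sqr_ge0. Qed.

Lemma mulc_conj z : z * conjc z = (cmod z ^+ 2)%:C.
Proof.
by rewrite cmod_sqr; case: z => x y; apply/eqP; rewrite eq_complex /=;
  apply/andP; split; apply/eqP; ring.
Qed.

Lemma Re_conj_polar z w :
  complex.Re ((z + w) * conjc (z - w)) = cmod z ^+ 2 - cmod w ^+ 2.
Proof. by rewrite !cmod_sqr; case: z => ? ?; case: w => ? ? /=; ring. Qed.

Lemma Re_conj_polarC z w :
  complex.Re ((z - w) * conjc (z + w)) = cmod z ^+ 2 - cmod w ^+ 2.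
Proof. by rewrite !cmod_sqr; case: z => ? ?; case: w => ? ? /=; ring. Qed.

Lemma cmod_sum (I : Type) (r : seq I) (F : I -> R[i]) :
  cmod (\sum_(i <- r) F i) <= \sum_(i <- r) cmod (F i).
Proof.
elim/big_ind2: _ => [|z s w t zs wt|//]; first by rewrite /cmod Normc.normc0.
exact: le_trans (le_normcD _ _) (lerD zs wt).
Qed.

Lemma cexpi0 : cexpi (0 : R) = 1.
Proof. by rewrite /cexpi cos0 sin0. Qed.

Lemma cexpiD (s t : R) : cexpi (s + t) = cexpi s * cexpi t.
Proof. by apply/eqP; rewrite eq_complex /= cosD sinD addrC eqxx /= addrC eqxx. Qed.

Lemma conj_cexpi (t : R) : conjc (cexpi t) = cexpi (- t).
Proof. by rewrite /cexpi cosN sinN. Qed.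

Lemma cmod_cexpi (t : R) : cmod (cexpi t) = 1.
Proof. by rewrite /cmod /= cos2Dsin2 sqrtr1. Qed.

Lemma cexpiMn (t : R) (n : nat) : cexpi (n%:R * t) = cexpi t ^+ n.
Proof.
elim: n => [|n IH]; first by rewrite mul0r cexpi0 expr0.
by rewrite -natr1 mulrDl mul1r cexpiD IH exprSr.
Qed.

Lemma cexpi_2pi : cexpi (2 * pi : R) = 1.
Proof. by rewrite mulr_natl /cexpi cos2pi sin2pi. Qed.

(** Half-angle: 1 - cos t = 2 sin^2 (t/2), and the sine has no zero in the open
    interval from 0 to pi. *)
Lemma cexpi_eq1 (t : R) : `|t| < 2 * pi -> cexpi t = 1 -> t = 0.
Proof.
move=> tpi /(congr1 (@complex.Re R)) /= ct1.
have s0 : sin (t / 2) = 0.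
  have tE : t = (t / 2) *+ 2 by rewrite -mulr_natr divfK ?pnatr_eq0.
  move: ct1; rewrite [in cos t]tE cos_mulr2n cos2sin2 => ct1.
  by apply/eqP; rewrite -sqrf_eq0; apply/eqP; lra.
have pos (x : R) : 0 < x < 2 * pi -> sin (x / 2) <> 0.
  by move=> xpi; apply/eqP; rewrite gt_eqF// sin_gt0_pi//; lra.
case: (ltrgt0P t) => // t0.
- by case: (pos t) => //; rewrite gtr0_norm// in tpi; lra.
- case: (pos (- t)); last by rewrite mulNr sinN s0 oppr0.
  by rewrite ltr0_norm// in tpi; lra.
Qed.

Lemma sum_expr_root (z : R[i]) (N : nat) : z ^+ N = 1 -> z != 1 ->
  \sum_(m < N) z ^+ m = 0.
Proof.
move=> zN z1; apply/eqP; have /eqP := subrX1 z N.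
by rewrite zN subrr eq_sym mulf_eq0 subr_eq0 (negbTE z1).
Qed.

End ComplexArithmetic.

(** * Discrete Fourier inversion and Parseval *)

Section Fourier.
Local Open Scope complex_scope.
Set Implicit Arguments.
Unset Strict Implicit.
Context {R : realType} (a b : R) (N : nat).
Hypotheses (hab : a < b) (N0 : (0 < N)%N).
Implicit Types u v : grid R N.

Local Notation phase k j := (k%:~R * mu a b * node a b N j).

(** In terms of theta = 2 pi (j - l) / N the summand is the geometric sequence
    exp(i m theta) up to the phase of the shift by N/2, and exp(i theta) is an
    N-th root of unity different from 1 unless j = l. *)
Lemma cexpi_phase_sum (j l : 'I_N) :
  \sum_(m < N) cexpi (phase (mode m) j) * cexpi (- phase (mode m) l)
  = if j == l then N%:R else 0.
Proof.
case: eqVneq => [<-|jl].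
  under eq_bigr do rewrite -cexpiD subrr cexpi0.
  by rewrite sumr_const card_ord.
pose theta : R := 2 * pi * (j%:R - l%:R) / N%:R.
have Nr : N%:R != 0 :> R by rewrite pnatr_eq0 -lt0n.
have thetaE (m : 'I_N) : cexpi (phase (mode m) j) * cexpi (- phase (mode m) l)
    = cexpi (- (N./2)%:R * theta) * cexpi theta ^+ m.
  rewrite -cexpiD -cexpiMn -cexpiD; congr cexpi.
  rewrite /mode /mu /node /mesh /theta rmorphB /= -!pmulrn.
  by field; rewrite Nr subr_eq0 gt_eqF.
under eq_bigr do rewrite thetaE.
rewrite -mulr_sumr sum_expr_root ?mulr0//.
- rewrite -cexpiMn /theta mulrC divfK// mulrBr cexpiD -mulrN.
  rewrite ![2 * pi * _]mulrC cexpiMn cexpi_2pi expr1n mul1r.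
  by rewrite mulNr -conj_cexpi cexpiMn cexpi_2pi expr1n conjc1.
- have N0r : 0 < N%:R :> R by rewrite ltr0n.
  apply/eqP => /cexpi_eq1 theta0; suff /eqP : theta = 0.
    rewrite /theta mulf_eq0 invr_eq0 (negbTE Nr) orbF mulf_eq0 subr_eq0 eqr_nat.
    rewrite mulf_eq0 pnatr_eq0 (gt_eqF (pi_gt0 _)) /=.
    by rewrite (inj_eq val_inj) (negbTE jl).
  apply: theta0; rewrite /theta normrM normfV normrM.
  have pi0 : 0 < 2 * pi :> R by rewrite mulr_gt0 ?pi_gt0.
  rewrite [`|N%:R|]gtr0_norm// [`|2 * pi|]gtr0_norm//.
  rewrite ltr_pdivrMr// ltr_pM2l// ltr_norml.
  have := ltn_ord j; have := ltn_ord l; rewrite -!(ltr_nat R) => lN jN.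
  have := ler0n R j; have := ler0n R l; lra.
Qed.

Lemma dft_inversion u (j : 'I_N) :
  \sum_(m < N) dft a b u (mode m) * cexpi (phase (mode m) j) = u j.
Proof.
have Nr : N%:R != 0 :> R[i] by rewrite pnatr_eq0 -lt0n.
transitivity (\sum_(l < N) N%:R^-1 * u l *
    \sum_(m < N) cexpi (phase (mode m) j) * cexpi (- phase (mode m) l)).
  under [RHS]eq_bigr do rewrite mulr_sumr.
  rewrite [RHS]exchange_big /=; apply: eq_bigr => m _.
  by rewrite /dft mulr_sumr mulr_suml; apply: eq_bigr => l _; ring.
under eq_bigr do rewrite cexpi_phase_sum.
rewrite (bigD1 j)//= eqxx big1 ?addr0 => [|l lj].
  by rewrite mulrAC mulVf ?mul1r.
by rewrite eq_sym (negbTE lj) mulr0.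
Qed.

Lemma conj_dft v (k : int) :
  conjc (dft a b v k) = N%:R^-1 * \sum_(j < N) conjc (v j) * cexpi (phase k j).
Proof.
rewrite /dft rmorphM rmorph_sum /= conjc_inv conjc_nat; congr (_ * _).
apply: eq_bigr => j _; rewrite rmorphM; congr (_ * _).
exact: etrans (conj_cexpi _) (congr1 _ (opprK _)).
Qed.

(** A Fourier multiplier is diagonal on Fourier coefficients: the exponential
    moves onto the conjugated test function by an exchange of sums, without any
    orthogonality. *)
Lemma fourier_multiplier_pairing (w : 'I_N -> R[i]) u v :
  N%:R^-1 * \sum_(j < N)
    (\sum_(m < N) w m * dft a b u (mode m) * cexpi (phase (mode m) j))
      * conjc (v j)
  = \sum_(m < N) w m * (dft a b u (mode m) * conjc (dft a b v (mode m))).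
Proof.
under [RHS]eq_bigr do rewrite conj_dft !mulr_sumr.
rewrite exchange_big mulr_sumr /=; apply: eq_bigr => j _.
rewrite mulr_suml mulr_sumr; apply: eq_bigr => m _; ring.
Qed.

(** The pairing with multiplier 1, whose left side collapses by inversion. *)
Lemma parseval u :
  \sum_(m < N) cmod (dft a b u (mode m)) ^+ 2
  = N%:R^-1 * \sum_(j < N) cmod (u j) ^+ 2.
Proof.
apply: complexI.
transitivity (\sum_(m < N) 1 *
    (dft a b u (mode m) * conjc (dft a b u (mode m)))).
  by rewrite rmorph_sum; apply: eq_bigr => m _; rewrite mul1r mulc_conj.
rewrite -fourier_multiplier_pairing rmorphM fmorphV rmorph_nat rmorph_sum.
congr (_ * _); apply: eq_bigr => j _ /=; rewrite -mulc_conj.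
congr (_ * _); rewrite -[RHS]dft_inversion.
by apply: eq_bigr => m _; rewrite mul1r.
Qed.

End Fourier.

(** * Sums of inverse powers over the modes *)

Section Sums.
Local Open Scope complex_scope.
Set Implicit Arguments.
Unset Strict Implicit.
Context {R : realType}.

(** Cauchy-Schwarz, obtained by expanding the nonnegative sum of
    w (S x - X / w)^2 with S the sum of the 1/w and X the sum of the x. *)
Lemma sqr_sum_le_weighted (I : finType) (w x : I -> R) :
  (forall i, 0 < w i) ->
  (\sum_i x i) ^+ 2 <= (\sum_i (w i)^-1) * \sum_i w i * x i ^+ 2.
Proof.
move=> w0; set S := \sum_i (w i)^-1; set Q := \sum_i w i * _; set X := \sum_i x i.
have Sge0 : 0 <= S by apply: sumr_ge0 => i _; rewrite invr_ge0 ltW.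
have [S0|Sn0] := eqVneq S 0.
  have vac : I -> False.
    have inv0 j : true -> 0 <= (w j)^-1 by rewrite invr_ge0 ltW.
    move=> i; have /eqP : (w i)^-1 = 0 by exact: psumr_eq0P inv0 S0 _ _.
    by rewrite invr_eq0 gt_eqF.
  by rewrite /X big1 ?expr0n ?S0 ?mul0r// => i; case: (vac i).
have Sgt0 : 0 < S by rewrite lt_def Sn0.
have : 0 <= \sum_i w i * (S * x i - X / w i) ^+ 2.
  by apply: sumr_ge0 => i _; rewrite mulr_ge0 ?sqr_ge0 ?ltW.
have -> : \sum_i w i * (S * x i - X / w i) ^+ 2 = S * (S * Q - X ^+ 2).
  rewrite (eq_bigr (fun i => S ^+ 2 * (w i * x i ^+ 2) - 2 * S * X * x i
      + X ^+ 2 * (w i)^-1)) => [|i _]; last by field; rewrite gt_eqF.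
  rewrite big_split sumrB -!mulr_sumr /= -/S -/Q -/X; ring.
by rewrite pmulr_rge0// subr_ge0.
Qed.

(** Discrete counterpart of integrating -p y^(-p-1) over [x, x + 1].  After
    division by (x + 1)^(-p) it says p / (x + 1) <= ((x + 1) / x)^p - 1, which
    follows from 1 + y <= exp y and ln (1 + y) <= y. *)
Lemma powR_telescope_step (p x : R) : 0 < p -> 0 < x ->
  p * (x + 1) `^ (- (p + 1)) <= x `^ (- p) - (x + 1) `^ (- p).
Proof.
move=> p0 x0; have x10 : 0 < x + 1 by rewrite addr_gt0.
have -> : (x + 1) `^ (- (p + 1)) = (x + 1) `^ (- p) / (x + 1).
  by rewrite opprD powRB ?(gt_eqF x10) ?implybT// powRr1 // ltW.
have -> : x `^ (- p) = expR (p * ln ((x + 1) / x)) * (x + 1) `^ (- p).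
  by rewrite /powR !gt_eqF// -expRD ln_div ?posrE//; congr expR; ring.
rewrite -[X in _ - X]mul1r -mulrBl mulrCA mulrC ler_pM2r ?powR_gt0// lerBrDl.
apply: le_trans (expR_ge1Dx _); rewrite lerD2l ler_pM2l//.
rewrite -[(x + 1) / x]invrK lnV ?posrE ?invr_gt0 ?divr_gt0// lerNr.
have -> : ((x + 1) / x)^-1 = 1 + - (x + 1)^-1 by field; rewrite !gt_eqF.
by apply: le_ln1Dx; rewrite ltrN2 invf_lt1// ltrDr.
Qed.

Lemma sum_powR_le (p x : R) (n : nat) : 0 < p -> 0 < x ->
  \sum_(j < n) (x + 1 + j%:R) `^ (- (p + 1)) <= x `^ (- p) / p.
Proof.
move=> p0 x0; rewrite ler_pdivlMr// mulrC.
suff : p * \sum_(j < n) (x + 1 + j%:R) `^ (- (p + 1))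
    <= x `^ (- p) - (x + n%:R) `^ (- p).
  by move/le_trans; apply; rewrite gerBl powR_ge0.
elim: n => [|n IH]; first by rewrite big_ord0 mulr0 addr0 subrr.
rewrite big_ord_recr /= mulrDr -natr1.
have := @powR_telescope_step p (x + n%:R) p0 (ltr_wpDr (ler0n _ _) x0).
have -> : x + n%:R + 1 = x + 1 + n%:R by ring.
have -> : x + (n%:R + 1) = x + 1 + n%:R by ring.
lra.
Qed.

(** If y is the larger number, then x + y <= 2 y. *)
Lemma powR_add_le (r x y : R) : 0 <= r -> 0 <= x -> 0 <= y ->
  (x + y) `^ r <= 2 `^ r * (x `^ r + y `^ r).
Proof.
move=> r0; wlog xy : x y / x <= y => [wl x0 y0|x0 y0].
  case: (leP x y) => [/wl|/ltW/wl]; first exact.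
  by rewrite addrC [_ `^ r + _]addrC; exact.
apply: (@le_trans _ _ ((2 * y) `^ r)).
  by apply: ge0_ler_powR; rewrite ?nnegrE ?addr_ge0 ?mulr_ge0//; lra.
by rewrite powRM// ler_pM2l ?powR_gt0// lerDr powR_ge0.
Qed.

(** Each absolute value |k| is attained by at most two modes, one negative and
    one nonnegative; the negative ones are taken in reverse order. *)
Lemma sum_mode_le (N : nat) (f : nat -> R) (B : R) : ~~ odd N ->
  (forall k, 0 <= f k) -> (forall n, \sum_(j < n) f j <= B) ->
  \sum_(m < N) f `|mode m|%N <= B + B.
Proof.
move=> evN f0 fB; have NE : N = (N./2 + N./2)%N.
  by rewrite addnn -[LHS]odd_double_half (negbTE evN).
move: (N./2) NE => n NE; rewrite {N evN}NE big_split_ord /=; apply: lerD.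
- apply: le_trans (fB n.+1); rewrite big_ord_recl.
  rewrite (reindex_inj rev_ord_inj) /= ler_wpDl//.
  apply: ler_sum => i _; rewrite /mode /= addnn doubleK.
  by rewrite -subzn// addrAC subrr add0r abszN.
- apply: le_trans (fB n); apply: ler_sum => i _.
  by rewrite /mode /= addnn doubleK PoszD addrAC subrr add0r absz_nat.
Qed.

End Sums.

(** * Discrete Sobolev inequality *)

Section Sobolev.
Local Open Scope complex_scope.
Set Implicit Arguments.
Unset Strict Implicit.
Context {R : realType} (a b : R).
Hypothesis hab : a < b.

(** The p-th power of the discrete l^p norm: the root is left out because the
    conservation laws are additive in these powers. *)
Definition lp_mean (p N : nat) (u : grid R N) : R :=
  N%:R^-1 * \sum_(j < N) cmod (u j) ^+ p.

Lemma lp_mean_ge0 (p N : nat) (u : grid R N) : 0 <= lp_mean p u.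
Proof.
by rewrite mulr_ge0 ?invr_ge0// sumr_ge0// => j _; rewrite exprn_ge0 ?cmod_ge0.
Qed.

Lemma Re_inner_h (N : nat) (u v : grid R N) : complex.Re (inner_h u v)
  = N%:R^-1 * \sum_(j < N) complex.Re (u j * conjc (v j)).
Proof.
by rewrite /inner_h -(rmorph_nat (real_complex R)) -fmorphV Re_scale Re_sum.
Qed.

Lemma Im_inner_h (N : nat) (u v : grid R N) : complex.Im (inner_h u v)
  = N%:R^-1 * \sum_(j < N) complex.Im (u j * conjc (v j)).
Proof.
by rewrite /inner_h -(rmorph_nat (real_complex R)) -fmorphV Im_scale Im_sum.
Qed.

Lemma norm_h_sqr (N : nat) (u : grid R N) : norm_h u ^+ 2 = lp_mean 2 u.
Proof.
rewrite /norm_h Re_inner_h.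
under eq_bigr do rewrite mulc_conj.
by rewrite sqr_sqrtr// lp_mean_ge0.
Qed.

Lemma seminormH_sqr (s : R) (N : nat) (u : grid R N) :
  seminormH a b s u ^+ 2 = \sum_(m < N)
    `|mu a b * (mode m)%:~R| `^ (2 * s) * cmod (dft a b u (mode m)) ^+ 2.
Proof.
by rewrite sqr_sqrtr// sumr_ge0// => m _; rewrite mulr_ge0 ?powR_ge0 ?sqr_ge0.
Qed.

Lemma norm_linf_ge (N : nat) (u : grid R N) j : cmod (u j) <= norm_linf u.
Proof. exact: (le_bigmax_cond 0 (fun j => cmod (u j)) (isT : xpredT j)). Qed.

Lemma norm_linf_ge0 (N : nat) (u : grid R N) : 0 <= norm_linf u.
Proof.
rewrite /norm_linf; elim/big_ind: _ => [//|x y x0 y0|j _].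
  by rewrite le_max x0.
exact: cmod_ge0.
Qed.

Lemma norm_linf_le_sum_dft (N : nat) (u : grid R N) : (0 < N)%N ->
  norm_linf u <= \sum_(m < N) cmod (dft a b u (mode m)).
Proof.
move=> N0; apply: bigmax_le => [|j _].
  by apply: sumr_ge0 => m _; exact: cmod_ge0.
rewrite -(@dft_inversion _ a b N hab N0 u j); apply: le_trans (cmod_sum _ _) _.
apply: ler_sum => m _.
by rewrite /cmod Normc.normcM -/(cmod (cexpi _)) cmod_cexpi mulr1.
Qed.

(** The condition al/2 > 1/2 is the range of the one-dimensional Sobolev
    embedding into bounded functions.  The weights (B + 1 + |k|)^al compare with
    (B + 1)^al + |k|^al up to a factor 2^al, so that the weighted Cauchy-Schwarz
    inequality involves the norm and the semi-norm only; the coefficient of the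
    latter is B^(1 - al) times a constant G independent of N. *)
Lemma discrete_sobolev (al eps : R) : 1 < al -> 0 < eps ->
  exists2 K : R, 0 <= K &
    forall (N : nat) (u : grid R N), (0 < N)%N -> ~~ odd N ->
      norm_linf u ^+ 2
        <= eps * seminormH a b (al / 2) u ^+ 2 + K * norm_h u ^+ 2.
Proof.
move=> al1 eps0; pose p := al - 1; have p0 : 0 < p by rewrite subr_gt0.
have al0 : 0 < al by lra.
have mu0 : 0 < mu a b by rewrite divr_gt0 ?subr_gt0// mulr_gt0// pi_gt0.
pose M := 2 / p * 2 `^ al.
have M0 : 0 < M by rewrite !mulr_gt0 ?invr_gt0 ?powR_gt0//.
pose G := M / mu a b `^ al; have G0 : 0 < G by rewrite divr_gt0// powR_gt0.
(* B solves B^(- p) G = eps, so the semi-norm gets the coefficient eps. *)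
pose B := (eps / G) `^ (- p^-1); have B0 : 0 < B by rewrite powR_gt0// divr_gt0.
have BE : B `^ (- p) = eps / G.
  by rewrite /B -powRrM mulrNN mulVf ?gt_eqF// powRr1// divr_ge0 ?ltW.
exists (B `^ (- p) * M * (B + 1) `^ al).
  by rewrite mulr_ge0 ?powR_ge0// mulr_ge0 ?powR_ge0// ltW.
move=> N u N0 evN.
pose w (k : nat) : R := (B + 1 + k%:R) `^ al.
have w0 k : 0 < w k by rewrite powR_gt0// ltr_wpDr ?addr_gt0.
pose c (m : 'I_N) := cmod (dft a b u (mode m)).
have le1 : norm_linf u ^+ 2 <= (\sum_(m < N) c m) ^+ 2.
  rewrite ler_sqr ?nnegrE ?norm_linf_ge0 ?norm_linf_le_sum_dft//.
  by apply: sumr_ge0 => m _; exact: cmod_ge0.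
have le2 :=
  @sqr_sum_le_weighted _ _ (fun m : 'I_N => w `|mode m|%N) c (fun m => w0 _).
have le3 : \sum_(m < N) (w `|mode m|%N)^-1 <= B `^ (- p) * (2 / p).
  have -> : B `^ (- p) * (2 / p) = B `^ (- p) / p + B `^ (- p) / p.
    by field; rewrite gt_eqF.
  apply: (sum_mode_le (f := fun k => (w k)^-1)) => // [k|n].
    by rewrite invr_ge0 ltW.
  apply: le_trans (sum_powR_le n p0 B0).
  by apply: ler_sum => j _; rewrite /w -powRN /p subrK.
have le4 : \sum_(m < N) w `|mode m|%N * c m ^+ 2
    <= 2 `^ al * ((B + 1) `^ al * norm_h u ^+ 2
        + seminormH a b (al / 2) u ^+ 2 / mu a b `^ al).
  rewrite norm_h_sqr /lp_mean -(parseval hab N0) seminormH_sqr mulr_suml.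
  rewrite !mulr_sumr -big_split mulr_sumr /=; apply: ler_sum => m _.
  have -> : 2 * (al / 2) = al by field.
  rewrite normrM (gtr0_norm mu0) powRM ?(ltW mu0)//.
  have -> : `|(mode m)%:~R| = (`|mode m|%N)%:R :> R.
    by rewrite -intr_norm -abszE -pmulrn.
  rewrite -/(c m) [X in _ <= _ * (_ + X)](_ : _ =
    (`|mode m|%N)%:R `^ al * c m ^+ 2); last first.
    by field; rewrite gt_eqF// powR_gt0.
  rewrite -mulrDl mulrA ler_wpM2r ?sqr_ge0// powR_add_le//; first exact: ltW.
  by rewrite addr_ge0// ltW.
apply: le_trans le1 (le_trans le2 _).
apply: le_trans (ler_pM _ _ le3 le4) _.
- by apply: sumr_ge0 => m _; rewrite invr_ge0 ltW.
- by apply: sumr_ge0 => m _; rewrite mulr_ge0 ?sqr_ge0 ?ltW.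
rewrite BE le_eqVlt; apply/orP; left; apply/eqP.
rewrite /G /M; field.
by rewrite !gt_eqF ?powR_gt0.
Qed.

Lemma lp_mean4_le (N : nat) (u : grid R N) :
  lp_mean 4 u <= norm_linf u ^+ 2 * norm_h u ^+ 2.
Proof.
rewrite norm_h_sqr /lp_mean mulrCA ler_wpM2l ?invr_ge0// mulr_sumr.
apply: ler_sum => j _; rewrite (exprD _ 2 2) ler_wpM2r ?sqr_ge0//.
by rewrite ler_sqr ?nnegrE ?cmod_ge0 ?norm_linf_ge0// norm_linf_ge.
Qed.

End Sobolev.

(** * Conservation of mass and energy *)

Section Conservation.
Local Open Scope complex_scope.
Set Implicit Arguments.
Unset Strict Implicit.
Context {R : realType} (a b alpha beta t : R) (N : nat).
Hypothesis t0 : t != 0.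
Implicit Types u v : grid R N.

Lemma dftD u v k : dft a b (u + v) k = dft a b u k + dft a b v k.
Proof.
rewrite /dft -mulrDr -big_split; congr (_ * _); apply: eq_bigr => j _.
by rewrite ffunE mulrDl.
Qed.

Lemma dftZ (c : R[i]) u k : dft a b (c *: u) k = c * dft a b u k.
Proof.
rewrite /dft [RHS]mulrCA; congr (_ * _). rewrite mulr_sumr; apply: eq_bigr => j _.
by rewrite ffunE; exact/esym/mulrA.
Qed.

Lemma dftB u v k : dft a b (u - v) k = dft a b u k - dft a b v k.
Proof. by rewrite -scaleN1r dftD dftZ mulN1r. Qed.

Lemma inner_hDl u v g : inner_h (u + v) g = inner_h u g + inner_h v g.
Proof.
rewrite /inner_h -mulrDr -big_split; congr (_ * _); apply: eq_bigr => j _.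
by rewrite ffunE mulrDl.
Qed.

Lemma inner_hZl (c : R[i]) u g : inner_h (c *: u) g = c * inner_h u g.
Proof.
rewrite /inner_h [RHS]mulrCA; congr (_ * _); rewrite mulr_sumr.
apply: eq_bigr => j _.
by rewrite ffunE; exact/esym/mulrA.
Qed.

Lemma inner_hBl u v g : inner_h (u - v) g = inner_h u g - inner_h v g.
Proof. by rewrite -scaleN1r inner_hDl inner_hZl mulN1r. Qed.

Lemma inner_h0l g : inner_h (0 : grid R N) g = 0.
Proof. by rewrite -(scale0r (0 : grid R N)) inner_hZl mul0r. Qed.

Lemma inner_h_Dfrac u v : inner_h (Dfrac a b alpha u) v =
  \sum_(m < N) (`|mu a b * (mode m)%:~R| `^ alpha)%:C
      * (dft a b u (mode m) * conjc (dft a b v (mode m))).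
Proof.
rewrite -fourier_multiplier_pairing /inner_h; congr (_ * _).
by apply: eq_bigr => j _; rewrite ffunE.
Qed.

Definition scheme_step u v := (0 +i* 1) *: ((t^-1)%:C *: (v - u))
  - Dfrac a b alpha ((2^-1 : R[i]) *: (v + u)) + nonlin beta u v = 0.

Lemma scheme_step_tested u v g : scheme_step u v ->
  (0 +i* 1) * ((t^-1)%:C * inner_h (v - u) g)
  - \sum_(m < N) (`|mu a b * (mode m)%:~R| `^ alpha / 2)%:C
      * (dft a b (v + u) (mode m) * conjc (dft a b g (mode m)))
  + inner_h (nonlin beta u v) g = 0.
Proof.
rewrite -[RHS](inner_h0l g) => <-.
rewrite [RHS]inner_hDl; congr (_ + _).
rewrite [RHS]inner_hBl !inner_hZl inner_h_Dfrac; congr (_ - _).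
apply: eq_bigr => m _.
by rewrite dftZ rmorphM fmorphV rmorph_nat /=; ring.
Qed.

Lemma Re_iscale (c : R) (z : R[i]) :
  complex.Re ((0 +i* 1) * (c%:C * z)) = - (c * complex.Im z).
Proof. by case: z => x y /=; ring. Qed.

Lemma Im_iscale (c : R) (z : R[i]) :
  complex.Im ((0 +i* 1) * (c%:C * z)) = c * complex.Re z.
Proof. by case: z => x y /=; ring. Qed.

(** The dispersive and nonlinear terms tested with v + u are combinations of
    squared moduli with real coefficients, hence invisible to the imaginary
    part. *)
Lemma mass_step u v : scheme_step u v -> norm_h v ^+ 2 = norm_h u ^+ 2.
Proof.
move=> /(scheme_step_tested (v + u)) /(congr1 (@complex.Im R)).
rewrite !raddfD raddfN /= Im_iscale Im_sum Re_inner_h Im_inner_h.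
under [X in _ - X]eq_bigr do rewrite mulc_conj -rmorphM.
rewrite [X in _ - X]big1 // subr0.
under [X in _ + _ * X]eq_bigr do
  rewrite !ffunE [u _ + v _]addrC -mulrA mulc_conj -rmorphM.
rewrite [X in _ + _ * X]big1 // mulr0 addr0.
under eq_bigr do rewrite !ffunE Re_conj_polarC.
rewrite sumrB mulrBr => /eqP; rewrite mulf_eq0 invr_eq0 (negbTE t0) /= subr_eq0.
by rewrite !norm_h_sqr => /eqP.
Qed.

(** The inner product of i (v - u) with v - u is purely imaginary, and the real
    parts of both remaining terms are differences by
    Re ((z + w) conj (z - w)) = |z|^2 - |w|^2, in Fourier space for the
    Laplacian and pointwise for the nonlinearity. *)
Lemma energy_step u v : scheme_step u v ->
  seminormH a b (alpha / 2) v ^+ 2 - beta / 2 * lp_mean 4 v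
  = seminormH a b (alpha / 2) u ^+ 2 - beta / 2 * lp_mean 4 u.
Proof.
move=> /(scheme_step_tested (v - u)) /(congr1 (@complex.Re R)).
rewrite !raddfD raddfN /= Re_iscale Re_sum Re_inner_h Im_inner_h.
under eq_bigr do rewrite mulc_conj.
rewrite big1 // !mulr0 oppr0 add0r.
under eq_bigr do rewrite dftD dftB Re_scale Re_conj_polar mulrBr.
under [X in _ + _ * X]eq_bigr do
  rewrite ffunE -mulrA Re_scale !ffunE [u _ + v _]addrC Re_conj_polar.
rewrite sumrB.
rewrite !seminormH_sqr (_ : 2 * (alpha / 2) = alpha); last by field.
have half w : \sum_(m < N) `|mu a b * (mode m)%:~R| `^ alpha / 2
      * cmod (dft a b w (mode m)) ^+ 2
    = 2^-1 * \sum_(m < N) `|mu a b * (mode m)%:~R| `^ alpha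
      * cmod (dft a b w (mode m)) ^+ 2.
  by rewrite mulr_sumr; apply: eq_bigr => m _; ring.
rewrite !half /lp_mean.
rewrite [X in _ + _ * X](_ : _ = beta / 4 * \sum_(j < N) cmod (v j) ^+ 4
    - beta / 4 * \sum_(j < N) cmod (u j) ^+ 4).
  lra.
by rewrite !mulr_sumr -sumrB; apply: eq_bigr => j _; ring.
Qed.

End Conservation.

Section Trajectory.
Local Open Scope complex_scope.
Set Implicit Arguments.
Unset Strict Implicit.
Context {R : realType} (a b T alpha beta : R) (N Nt : nat).
Hypotheses (hT : 0 < T) (Nt0 : (0 < Nt)%N).
Variable U : nat -> grid R N.
Hypothesis sol : scheme_solution a b T alpha beta Nt U.

Lemma mass_energy_conserved n : (n <= Nt)%N ->
  norm_h (U n) ^+ 2 = norm_h (U 0%N) ^+ 2 /\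
  seminormH a b (alpha / 2) (U n) ^+ 2 - beta / 2 * lp_mean 4 (U n)
  = seminormH a b (alpha / 2) (U 0%N) ^+ 2 - beta / 2 * lp_mean 4 (U 0%N).
Proof.
have tau0 : tau T Nt != 0 by rewrite gt_eqF// divr_gt0// ltr0n.
elim: n => [//|n IH] nNt; have [<- <-] := IH (ltnW nNt).
have step : scheme_step a b alpha beta (tau T Nt) (U n) (U n.+1) := sol nNt.
by split; [exact (mass_step tau0 step) | exact (energy_step step)].
Qed.

End Trajectory.

(** * Uniform bounds *)

Theorem theorem3p2 (R : realType) (a b T alpha beta M0 M1 : R)
    (hab : a < b) (hT : 0 < T) (halpha : 1 < alpha <= 2) :
  exists C1 C2 C3 : R,
    [/\ 0 < C1, 0 < C2, 0 < C3 &
      forall (N Nt : nat) (U : nat -> grid R N),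
        (0 < N)%N -> ~~ odd N -> (0 < Nt)%N ->
        norm_h (U 0%N) <= M0 ->
        seminormH a b (alpha / 2) (U 0%N) <= M1 ->
        scheme_solution a b T alpha beta Nt U ->
        forall n : nat, (n <= Nt)%N ->
          [/\ norm_h (U n) <= C1,
              seminormH a b (alpha / 2) (U n) <= C2
            & norm_linf (U n) <= C3]].
Proof.
have al1 : 1 < alpha by case/andP: halpha.
pose q := `|beta| * M0 ^+ 2; have q0 : 0 <= q by rewrite mulr_ge0 ?sqr_ge0.
pose eps := (1 + q)^-1; have eps0 : 0 < eps by rewrite invr_gt0 ltr_pwDl.
have [K K0 sob] := discrete_sobolev hab al1 eps0.
pose S2 := 3 * M1 ^+ 2 + 2 * (q * K * M0 ^+ 2).
pose S3 := eps * S2 + K * M0 ^+ 2.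
have le_sqr1 (x y : R) : x ^+ 2 <= y -> x <= 1 + y by move=> xy; nra.
have S20 : 0 <= S2.
  have := mulr_ge0 (mulr_ge0 q0 K0) (sqr_ge0 M0); have := sqr_ge0 M1.
  by rewrite /S2; lra.
have S30 : 0 <= S3 by rewrite addr_ge0// mulr_ge0 ?sqr_ge0// ltW.
exists (1 + M0 ^+ 2), (1 + S2), (1 + S3); split; try by rewrite ltr_pwDl ?sqr_ge0.
move=> N Nt U N0 evN Nt0 U0M0 U0M1 sol n nNt.
have [mass energy] := mass_energy_conserved hT Nt0 sol nNt.
have sqr_le (x y : R) : 0 <= x -> x <= y -> x ^+ 2 <= y ^+ 2 by move=> *; nra.
have m0 := sqr_le _ _ (sqrtr_ge0 _) U0M0.
have h0 := sqr_le _ _ (sqrtr_ge0 _) U0M1.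
rewrite -/(norm_h _) -/(seminormH _ _ _ _) in m0 h0.
(* The choice of eps makes the coefficient of the squared semi-norm
   q / (1 + q) <= 1, while the energy contains only half of beta Q(u): half of
   the squared semi-norm at time n is left over. *)
have quartic (u : grid R N) : norm_h u ^+ 2 <= M0 ^+ 2 ->
    `|beta * lp_mean 4 u|
      <= seminormH a b (alpha / 2) u ^+ 2 + q * K * M0 ^+ 2.
  move=> um; rewrite normrM (ger0_norm (lp_mean_ge0 _ _)).
  have l4 : lp_mean 4 u <= (eps * seminormH a b (alpha / 2) u ^+ 2
      + K * M0 ^+ 2) * M0 ^+ 2.
    apply: le_trans (lp_mean4_le u) _.
    apply: ler_pM => //; rewrite ?sqr_ge0//; apply: le_trans (sob N u N0 evN) _.
    by rewrite lerD2l ler_wpM2l.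
  apply: le_trans (ler_wpM2l (normr_ge0 beta) l4) _.
  rewrite [leLHS](_ : _ = q * eps * seminormH a b (alpha / 2) u ^+ 2
      + q * K * M0 ^+ 2); last by rewrite /q; ring.
  rewrite lerD2r ler_piMl ?sqr_ge0// ler_pdivrMr ?ltr_pwDl//.
  by rewrite mul1r lerDr.
have qn := quartic (U n); have q0' := quartic (U 0%N) m0.
rewrite mass in qn; have {}qn := qn m0.
have hn : seminormH a b (alpha / 2) (U n) ^+ 2 <= S2.
  by move: qn q0'; rewrite /S2 !ler_norml => /andP[? ?] /andP[? ?]; lra.
split; apply: le_sqr1; rewrite ?mass//.
apply: le_trans (sob N (U n) N0 evN) _.
by rewrite mass lerD// ler_wpM2l// ltW.
Qed.
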